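(* Let $t_1,t_3,t_4,m_1\in\mathbb{R}$ and let $\mathfrak g$ be the real linear span of $E_1=\begin{pmatrix} t_1&t_3+it_4&-\frac{i}{2}(t_1m_1+t_4^2+t_3^2)&1\\2t_3-2it_4&0&im_1(-t_3+it_4)&0\\4i&0&2m_1&0\\0&0&0&0\end{pmatrix}$, $E_2=\begin{pmatrix}0&t_4-it_3&\frac12(t_3^2+t_4^2)&i\\0&0&0&0\\0&0&0&0\\0&0&0&0\end{pmatrix}$, $E_3=\begin{pmatrix}t_3-it_4&-m_1&\frac{i}{2}m_1(-t_3+it_4)&0\\0&-2it_4&\frac{i}{2}(-t_3+it_4)(t_3+it_4)&1\\0&2i&0&0\\0&0&0&0\end{pmatrix}$, $E_4=\begin{pmatrix}-t_4-it_3&im_1&\frac12 m_1(-t_3+it_4)&0\\0&-2it_3&\frac12(t_3^2+t_4^2)&i\\0&2&0&0\\0&0&0&0\end{pmatrix}$, $E_5=\begin{pmatrix}-\frac{i}{2}(t_3^2+t_4^2)&\frac{i}{2}m_1(t_3+it_4)&-\frac14 m_1(t_3^2+t_4^2)&0\\0&-\frac{i}{2}(t_3^2+t_4^2)&0&0\\0&0&-\frac{i}{2}(t_3^2+t_4^2)&1\\0&0&0&0\end{pmatrix}$. Then every integral variety of type $(1/2,0)$ related to $\mathfrak g$ is affinely equivalent to (an open piece of) one of the hypersurfaces 1) $v=2x_1^2+|z_2|^2$; 2) $v=-\ln(1+x_1)+|z_2|^2$; 3) $\mathrm{Re}(\bar z_1 w)=(\mathrm{Re}(z_1\bar z_2))^{\alpha}$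 for some $\alpha\in(-\infty,0)$.
   Context: Coordinates in $\mathbb{C}^3$ are $z_1=x_1+iy_1$, $z_2=x_2+iy_2$, $w=u+iv$, $z=(z_1,z_2)$. To a complex $4\times4$ matrix $\begin{pmatrix}a_1&a_2&a_3&p\\ b_1&b_2&b_3&s\\ c_1&c_2&c_3&q\\0&0&0&0\end{pmatrix}$ one associates the holomorphic affine vector field $Z=(a_1z_1+a_2z_2+a_3w+p)\frac{\partial}{\partial z_1}+(b_1z_1+b_2z_2+b_3w+s)\frac{\partial}{\partial z_2}+(c_1z_1+c_2z_2+c_3w+q)\frac{\partial}{\partial w}$. For a real linear span $\mathfrak g$ of such matrices, an integral variety of type $(1/2,0)$ related to $\mathfrak g$ is a real-analytic strictly pseudoconvex real hypersurface $M$ defined near $0\in\mathbb{C}^3$, with $0\in M$, given near $0$ by an equation $v=|z_1|^2+|z_2|^2+\frac12(z_1^2+\bar z_1^2)+\sum_{k+l+2m\ge 3}F_{klm}(z,\bar z)u^m$ (with $F_{klm}$ a polynomial of degree $k$ in $z$ and $l$ in $\bar z$, the right-hand side real), such that for every $Z\in\mathfrak g$ the real vector field $Z+\bar Z$ is tangent to $M$, i.e. $\mathrm{Re}(Z(\Phi))|_M=0$ for a defining function $\Phi$ of $M$. Two hypersurfaces are affinely equivalent if a complex affine transformation of $\mathbb{C}^3$ maps a neighbourhood in one onto an open piece of the other. *)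

(* Defs.v *)
(* MathComp + MathComp-Analysis (R : realType), complex numbers R[i]
   from mathcomp-real-closed. *)
From HB Require Import structures.
From mathcomp Require Import all_boot all_order all_algebra.
From mathcomp Require Import complex.
From mathcomp Require Import all_classical all_reals all_analysis.

Set Implicit Arguments.
Unset Strict Implicit.
Unset Printing Implicit Defensive.

Import Order.TTheory GRing.Theory Num.Theory.
Import numFieldNormedType.Exports.
Local Open Scope ring_scope.
Local Open Scope complex_scope.
Local Open Scope classical_set_scope.

Section Defs.
Variable R : realType.
Local Notation C := R[i].

(* Points of C^3 : p 0 = z1, p 1 = z2, p 2 = w.                              *)
Definition pt := 'I_3 -> C.

(* Real and imaginary parts (record projections of R[i]). *)
Definition ReC (z : C) : R := complex.Re z.
Definition ImC (z : C) : R := complex.Im z.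

Definition i0 : 'I_3 := @Ordinal 3 0 isT.
Definition i1 : 'I_3 := @Ordinal 3 1 isT.
Definition i2 : 'I_3 := @Ordinal 3 2 isT.

(* A 4x4 complex matrix from its list of rows. *)
Definition mx_of_rows (rows : seq (seq C)) : 'M[C]_4 :=
  \matrix_(i < 4, j < 4) nth 0 (nth [::] rows i) j.

(* The holomorphic affine vector field associated with A, evaluated at p:
   its i-th component is  A_{i1} z1 + A_{i2} z2 + A_{i3} w + A_{i4}.       *)
Definition vf (A : 'M[C]_4) (p : pt) : pt := fun i =>
  \sum_(j < 3) A (widen_ord (leqnSn 3) i) (widen_ord (leqnSn 3) j) * p j
  + A (widen_ord (leqnSn 3) i) ord_max.

(* Real coordinates (x1,y1,x2,y2,u) of a point of C^3. *)
Definition coords (p : pt) : 'I_5 -> R := fun k =>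
  match val k with
  | 0 => ReC (p i0) | 1 => ImC (p i0)
  | 2 => ReC (p i1) | 3 => ImC (p i1)
  | _ => ReC (p i2) end.

(* Monomials and (finite, total-degree-truncated) partial sums of a power
   series in the five real variables (x1,y1,x2,y2,u).                      *)
Definition mono (x : 'I_5 -> R) (al : 'I_5 -> nat) : R :=
  \prod_(k < 5) x k ^+ al k.

Definition psum (a : ('I_5 -> nat) -> R) (N : nat) (x : 'I_5 -> R) : R :=
  \sum_(al : {ffun 'I_5 -> 'I_N.+1} | (\sum_(k < 5) (al k : nat) <= N)%N)
     a (fun k => al k : nat) * mono x (fun k => al k : nat).

Definition psumabs (a : ('I_5 -> nat) -> R) (N : nat) (x : 'I_5 -> R) : R :=
  \sum_(al : {ffun 'I_5 -> 'I_N.+1} | (\sum_(k < 5) (al k : nat) <= N)%N)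
     `|a (fun k => al k : nat) * mono x (fun k => al k : nat)|.

(* Weighted degree: z-variables (x,y) weight 1, u weight 2.  Sum of the
   terms of weighted degree <= 2 of the series with coefficients a.        *)
Definition wsum_le2 (a : ('I_5 -> nat) -> R) (x : 'I_5 -> R) : R :=
  \sum_(al : {ffun 'I_5 -> 'I_3} |
        ((al (inord 0) : nat) + al (inord 1) + al (inord 2) + al (inord 3)
          + 2 * al (inord 4) <= 2)%N)
     a (fun k => al k : nat) * mono x (fun k => al k : nat).

(* Open box of radius r around 0 in C^3 (real coordinates). *)
Definition box (r : R) : set pt :=
  [set p | forall k : 'I_3, `|ReC (p k)| < r /\ `|ImC (p k)| < r].

(* Openness in C^3 = R^6. *)
Definition openC3 (W : set pt) : Prop :=
  forall q, W q -> exists2 e : R, 0 < e &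
    forall q' : pt, (forall k, `|ReC (q' k - q k)| < e /\ `|ImC (q' k - q k)| < e) ->
      W q'.

(* F is given on the box of radius r by an absolutely convergent power
   series with coefficients a, whose part of weighted degree <= 2 is
   |z1|^2 + |z2|^2 + (z1^2 + conj z1^2)/2 = (x1^2+y1^2) + (x2^2+y2^2) + (x1^2-y1^2). *)
Definition normal_series (r : R) (F : ('I_5 -> R) -> R) : Prop :=
  exists a : ('I_5 -> nat) -> R,
    (forall x, (forall k, `|x k| < r) ->
       (exists B : R, forall N, psumabs a N x <= B) /\
       ((fun N => psum a N x) @ \oo --> F x)) /\
    (forall x, wsum_le2 a x =
       (x (inord 0) ^+ 2 + x (inord 1) ^+ 2) + (x (inord 2) ^+ 2 + x (inord 3) ^+ 2)
       + (x (inord 0) ^+ 2 - x (inord 1) ^+ 2)).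

(* Defining function Phi = F(x1,y1,x2,y2,u) - v of M. *)
Definition Phi (F : ('I_5 -> R) -> R) (p : pt) : R := F (coords p) - ImC (p i2).

(* The hypersurface  v = F(...)  inside the box of radius r. *)
Definition hyp (r : R) (F : ('I_5 -> R) -> R) : set pt :=
  box r `&` [set p | ImC (p i2) = F (coords p)].

(* Z + conj Z tangent to M at every point of M: the derivative of Phi
   along the real vector field Z + conj Z vanishes on M, i.e.
   d/dt Phi(p + t Z(p)) |_{t=0} = 2 ReC (Z Phi)(p) = 0.                     *)
Definition tangent (A : 'M[C]_4) (r : R) (F : ('I_5 -> R) -> R) : Prop :=
  forall p, hyp r F p ->
    is_derive (0 : R) (1 : R)
      (fun t : R => Phi F (fun k => p k + t%:C * vf A p k)) (0 : R).

(* Integral variety of type (1/2,0) related to the real span of Es. *)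
Definition integral_variety (Es : 'I_5 -> 'M[C]_4) (r : R)
    (F : ('I_5 -> R) -> R) : Prop :=
  0 < r /\ normal_series r F /\
  forall c : 'I_5 -> R, tangent (\sum_(k < 5) (c k)%:C *: Es k) r F.

(* The five generators. *)
Definition Emats (t1 t3 t4 m1 : R) : 'I_5 -> 'M[C]_4 := fun k =>
  let T1 := t1%:C in let T3 := t3%:C in let T4 := t4%:C in let M1 := m1%:C in
  let I := 'i in let S := T3 ^+ 2 + T4 ^+ 2 in
  match val k with
  | 0 => mx_of_rows
      [:: [:: T1; T3 + I * T4; - (I / 2) * (T1 * M1 + T4 ^+ 2 + T3 ^+ 2); 1];
          [:: 2 * T3 - 2 * I * T4; 0; I * M1 * (- T3 + I * T4); 0];
          [:: 4 * I; 0; 2 * M1; 0];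
          [:: 0; 0; 0; 0]]
  | 1 => mx_of_rows
      [:: [:: 0; T4 - I * T3; S / 2; I];
          [:: 0; 0; 0; 0];
          [:: 0; 0; 0; 0];
          [:: 0; 0; 0; 0]]
  | 2 => mx_of_rows
      [:: [:: T3 - I * T4; - M1; (I / 2) * M1 * (- T3 + I * T4); 0];
          [:: 0; - 2 * I * T4; (I / 2) * (- T3 + I * T4) * (T3 + I * T4); 1];
          [:: 0; 2 * I; 0; 0];
          [:: 0; 0; 0; 0]]
  | 3 => mx_of_rows
      [:: [:: - T4 - I * T3; I * M1; M1 * (- T3 + I * T4) / 2; 0];
          [:: 0; - 2 * I * T3; S / 2; I];
          [:: 0; 2; 0; 0];
          [:: 0; 0; 0; 0]]
  | _ => mx_of_rows
      [:: [:: - (I / 2) * S; (I / 2) * M1 * (T3 + I * T4); - (M1 * S) / 4; 0];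
          [:: 0; - (I / 2) * S; 0; 0];
          [:: 0; 0; - (I / 2) * S; 1];
          [:: 0; 0; 0; 0]]
  end.

(* Model hypersurfaces (z1 = q 0, z2 = q 1, w = q 2). *)
Definition model1 : set pt :=
  [set q | ImC (q i2) = 2 * ReC (q i0) ^+ 2 + (ReC (q i1) ^+ 2 + ImC (q i1) ^+ 2)].

Definition model2 : set pt :=
  [set q | 0 < 1 + ReC (q i0) /\
           ImC (q i2) = - ln (1 + ReC (q i0)) + (ReC (q i1) ^+ 2 + ImC (q i1) ^+ 2)].

Definition model3 (alpha : R) : set pt :=
  [set q | 0 < ReC (q i0 * (q i1)^*) /\
           ReC ((q i0)^* * q i2) = ReC (q i0 * (q i1)^*) `^ alpha].

(* Complex affine transformation p |-> A p + b. *)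
Definition affmap (A : 'M[C]_3) (b : pt) (p : pt) : pt :=
  fun k => \sum_(j < 3) A k j * p j + b k.

(* Affine equivalence of (the germ at 0 of) M with an open piece of Q:
   an invertible complex affine map sends a neighbourhood of 0 in M onto
   Q intersected with an open set.                                          *)
Definition affinely_equiv_at0 (M Q : set pt) : Prop :=
  exists (A : 'M[C]_3) (b : pt) (s : R) (W : set pt),
    A \in unitmx /\ 0 < s /\ openC3 W /\
    affmap A b @` (M `&` box s) = Q `&` W.

End Defs.

(* Main.v *)
(* The five fields project to the coordinate frame of C^2 x R at 0, so tangency
   prescribes the derivative of F along every ray from 0: M is determined near 0,
   and it is the zero set of any function Psi with Psi(0) = 0 that is annihilated
   by the fields and satisfies dPsi/dv > 0.

   Put tau = t3 + i t4, S = |tau|^2, kappa = t1 + 2 m1 and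
     b = z1 - (i/2) m1 w,  l = 1 - tau z2 - (i/2) S w,  d = 1 + tau z2 - (i/2) S w.
   If S <> 0 the algebra is linear about the common zero of l, b, d.  For a root
   mu of mu^2 = kappa mu + 4 S, the form Re((mu b + d) conj l) is multiplied by mu
   under the first field and killed by the others; the two roots mu > 0 > nu give
   the invariant relation P_mu = P_nu^(mu/nu), which is model 3.  If S = 0 then
   l = d = 1 and X = Re b changes only under the first field, by 1 + kappa X,
   while v - |z2|^2 changes by 4 X; integrating gives model 1 for kappa = 0 and
   model 2 otherwise. *)
Require Import Defs.
From HB Require Import structures.
From mathcomp Require Import all_boot all_order all_algebra.
From mathcomp Require Import complex.
From mathcomp Require Import all_classical all_reals all_analysis.
From mathcomp Require Import ring lra.

Import Order.TTheory GRing.Theory Num.Theory.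
Import numFieldNormedType.Exports.
Local Open Scope ring_scope.
Local Open Scope classical_set_scope.

(** * Size of a convergent power series without constant term near the origin *)

Section PowerSeries.
Variable R : realType.
Implicit Types (x : 'I_5 -> R) (a : ('I_5 -> nat) -> R).

Lemma mono0 (al : 'I_5 -> nat) :
  (exists k, al k != 0%N) -> mono (fun=> 0 : R) al = 0.
Proof.
by case=> k al0; rewrite /mono (bigD1 k) //= expr0n (negbTE al0) mul0r.
Qed.

(** Shrinking the argument by [t <= 1] multiplies a monomial by [t] to its degree, and a nonconstant
    monomial has degree at least one. *)
Lemma normr_mono_le (t rho : R) x (al : 'I_5 -> nat) :
  0 <= t <= 1 -> (forall k, `|x k| <= t * rho) ->
  (exists k, al k != 0%N) -> `|mono x al| <= t * `|mono (fun=> rho) al|.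
Proof.
move=> /andP[t0 t1] xle [k0 al0].
have rho_ge k : `|x k| <= t * `|rho|.
  by apply: (le_trans (xle k)); rewrite ler_wpM2l // ler_norm.
rewrite /mono !normr_prod.
apply: (@le_trans _ _ (\prod_(k < 5) (t ^+ al k * `|rho ^+ al k|))).
  apply: ler_prod => k _; rewrite normr_ge0 /= !normrX -exprMn.
  by apply: lerXn2r => //; rewrite nnegrE // mulr_ge0.
rewrite big_split /= ler_wpM2r //; first exact: prodr_ge0.
(* The factor at [k0] satisfies [t ^+ al k0 <= t]; the remaining powers of [t] are at most 1. *)
rewrite (bigD1 k0) //= -[leRHS]mulr1.
apply: ler_pM => //.
- exact: exprn_ge0.
- by apply: prodr_ge0 => k _; exact: exprn_ge0.
- by rewrite -[leRHS]expr1; apply: ler_wiXn2l => //; rewrite lt0n.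
- by apply: prodr_ile1 => k _; rewrite exprn_ge0 //= exprn_ile1.
Qed.

Lemma wsum_le2_0 a : wsum_le2 a (fun=> 0) = a (fun=> 0%N).
Proof.
rewrite /wsum_le2 (bigD1 [ffun=> ord0]) /=; last by rewrite !ffunE.
rewrite big1 ?addr0 => [|al /andP[_ al_neq0]].
  rewrite /mono big1 => [|k _]; last by rewrite ffunE expr0.
  by rewrite mulr1; congr a; apply/funext => k; rewrite ffunE.
rewrite mono0 ?mulr0 //; apply: contrapT => /forallNP al0.
case/eqP: al_neq0; apply/ffunP => k; rewrite ffunE; apply/val_inj => /=.
by apply/eqP; move/negP: (al0 k); rewrite negbK.
Qed.

(** The normal form has no constant term, so each term of the series gains a factor [t] when the box
    shrinks by [t]. This gives both [F] = 0 at the origin (take [t = 0]) and continuity there. *)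
Lemma normal_series_small (r : R) (F : ('I_5 -> R) -> R) :
  0 < r -> normal_series r F ->
  exists2 K, 0 <= K & forall (t : R) x, 0 <= t <= 1 ->
    (forall k, `|x k| <= t * (r / 2)) -> `|F x| <= t * K.
Proof.
move=> r0 [a [conv wsum]].
have a0 : a (fun=> 0%N) = 0.
  by rewrite -wsum_le2_0 wsum expr0n /= subrr !addr0.
(* The absolute partial sums are bounded at the corner [(r/2, ..., r/2)], which lies strictly inside
   the box of convergence; that bound serves as [K]. *)
have r2 : `|r / 2| < r by rewrite gtr0_norm; lra.
have [[B leB] _] := conv (fun=> r / 2) (fun=> r2).
exists B; first by apply: le_trans (leB 0%N); apply: sumr_ge0.
move=> t x t01 xle.
have xr k : `|x k| < r by apply: (le_lt_trans (xle k)); case/andP: t01; nra.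
have [_ Fx] := conv x xr.
have t0 : 0 <= t by case/andP: t01.
have psum_le N : `|psum a N x| <= t * B.
  apply: (le_trans (ler_norm_sum _ _ _)).
  apply: (@le_trans _ _ (t * psumabs a N (fun=> r / 2))); last first.
    by rewrite ler_wpM2l.
  rewrite /psumabs mulr_sumr; apply: ler_sum => al _.
  have [/existsP [k al0]|/existsPn al0] := boolP [exists k, (al k : nat) != 0%N].
    rewrite !normrM mulrCA ler_wpM2l //; apply: normr_mono_le => //.
    by exists k.
  have -> : (fun k => al k : nat) = (fun=> 0%N).
    by apply/funext => k; apply/eqP; move: (al0 k); rewrite negbK.
  by rewrite a0 !mul0r normr0 mulr0.
apply: (@cvgr_to_le _ \oo _ _ (fun N => `|psum a N x|)).
  exact: cvg_norm.
by near=> N; exact: psum_le.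
Unshelve. all: by end_near. Qed.

End PowerSeries.

(** * Neighbourhoods of the origin and continuity of affine vector fields there *)

Section Near0.
Variable R : realType.
Local Open Scope complex_scope.

(** Generated by the boxes that occur in [hyp] and [affinely_equiv_at0], so that an eventual
    property yields directly a radius [s]. *)
Definition near0 : set_system (pt R) :=
  [set P | exists2 s : R, 0 < s & box s `<=` P].

Global Instance near0_filter : Filter near0.
Proof.
split.
- by exists 1.
- move=> P Q [s s0 sP] [t t0 tQ]; exists (Num.min s t); first by rewrite lt_min s0.
  move=> p pst; split; [apply: sP|apply: tQ] => k;
    by have [] := pst k; rewrite !lt_min => /andP[? ?] /andP[? ?]; split.
- by move=> P Q PQ [s s0 sP]; exists s => // p /sP; exact: PQ.
Qed.

Lemma cvg_Re_near0 (k : 'I_3) : ReC (p k) @[p --> near0] --> (0 : R).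
Proof.
apply/cvgrPdist_lt => e e0; exists e => // p /(_ k)[pe _].
by rewrite /= sub0r normrN.
Qed.

Lemma cvg_Im_near0 (k : 'I_3) : ImC (p k) @[p --> near0] --> (0 : R).
Proof.
apply/cvgrPdist_lt => e e0; exists e => // p /(_ k)[_ pe].
by rewrite /= sub0r normrN.
Qed.

Lemma ReC_D (z w : R[i]) : ReC (z + w) = ReC z + ReC w.
Proof. by case: z; case: w. Qed.

Lemma ImC_D (z w : R[i]) : ImC (z + w) = ImC z + ImC w.
Proof. by case: z; case: w. Qed.

Lemma ReC_M (z w : R[i]) : ReC (z * w) = ReC z * ReC w - ImC z * ImC w.
Proof. by case: z; case: w. Qed.

Lemma ImC_M (z w : R[i]) : ImC (z * w) = ReC z * ImC w + ImC z * ReC w.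
Proof. by case: z; case: w. Qed.

Lemma ReC_sum (I : finType) (z : I -> R[i]) :
  ReC (\sum_i z i) = \sum_i ReC (z i).
Proof. exact: (big_morph _ ReC_D (erefl _)). Qed.

Lemma ImC_sum (I : finType) (z : I -> R[i]) :
  ImC (\sum_i z i) = \sum_i ImC (z i).
Proof. exact: (big_morph _ ImC_D (erefl _)). Qed.

Lemma cvg_sum_near0 n (f : 'I_n -> pt R -> R) (l : 'I_n -> R) :
  (forall i, f i p @[p --> near0] --> l i) ->
  \sum_i f i p @[p --> near0] --> \sum_i l i.
Proof.
elim: n f l => [|n IH] f l fl.
  by rewrite big_ord0; under eq_fun do rewrite big_ord0; exact: cvg_cst.
rewrite big_ord_recl; under eq_fun do rewrite big_ord_recl.
by apply: cvgD => //; apply: IH.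
Qed.

Lemma cvg_coords_vf (A : 'M[R[i]]_4) (j : 'I_5) :
  coords (vf A p) j @[p --> near0] --> coords (vf A (fun=> 0)) j.
Proof.
have cRe (z : R[i]) k : ReC (z * p k) @[p --> near0] --> ReC (z * 0).
  under eq_fun do rewrite ReC_M.
  rewrite ReC_M; apply: cvgB; apply: cvgM; try exact: cvg_cst.
    exact: cvg_Re_near0.
  exact: cvg_Im_near0.
have cIm (z : R[i]) k : ImC (z * p k) @[p --> near0] --> ImC (z * 0).
  under eq_fun do rewrite ImC_M.
  rewrite ImC_M; apply: cvgD; apply: cvgM; try exact: cvg_cst.
    exact: cvg_Im_near0.
  exact: cvg_Re_near0.
have vRe i : ReC (vf A p i) @[p --> near0] --> ReC (vf A (fun=> 0) i).
  rewrite /vf ReC_D ReC_sum; under eq_fun do rewrite ReC_D ReC_sum.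
  by apply: cvgD; [exact: cvg_sum_near0 | exact: cvg_cst].
have vIm i : ImC (vf A p i) @[p --> near0] --> ImC (vf A (fun=> 0) i).
  rewrite /vf ImC_D ImC_sum; under eq_fun do rewrite ImC_D ImC_sum.
  by apply: cvgD; [exact: cvg_sum_near0 | exact: cvg_cst].
by case: j => -[|[|[|[|[|m]]]]] // ?;
  [exact: vRe|exact: vIm|exact: vRe|exact: vIm|exact: vRe].
Qed.

End Near0.

(** If [c A = 0] then [c = c (1 - A)], and the entrywise bound contracts the sum of the absolute
    values of the entries of [c] by the factor [n / (n + 1)]; hence [c = 0]. *)
Lemma near_identity_unitmx (R : realFieldType) n (A : 'M[R]_n) :
  (forall i j, `|(i == j)%:R - A i j| < n.+1%:R^-1) -> A \in unitmx.
Proof.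
move=> Aid; rewrite -row_free_unit -kermx_eq0; apply/rowV0P => c /sub_kermxP cA.
pose M := \sum_i `|c 0 i|.
have M0 : 0 <= M by exact: sumr_ge0.
have cM j : `|c 0 j| <= M * n.+1%:R^-1.
  have -> : c 0 j = \sum_i c 0 i * ((i == j)%:R - A i j).
    under eq_bigr do rewrite mulrBr.
    rewrite sumrB; have /rowP /(_ j) := cA; rewrite !mxE => ->.
    rewrite subr0 (bigD1 j) //= eqxx mulr1 big1 ?addr0 // => i /negbTE ->.
    by rewrite mulr0.
  apply: (le_trans (ler_norm_sum _ _ _)).
  rewrite mulr_suml; apply: ler_sum => i _.
  by rewrite normrM ler_wpM2l // ltW.
have : M <= M * (n%:R / n.+1%:R).
  apply: (@le_trans _ _ (\sum_(j < n) M * n.+1%:R^-1)); first exact: ler_sum.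
  by rewrite sumr_const card_ord -[leLHS]mulr_natr -mulrA [_^-1 * _]mulrC.
have -> : n%:R / n.+1%:R = 1 - n.+1%:R^-1 :> R.
  have nS : n%:R + 1 != 0 :> R by rewrite natr1 pnatr_eq0.
  by rewrite -natr1; field.
rewrite mulrBr mulr1 lerBrDr gerDl => M1.
have Me : M = 0.
  apply/eqP; rewrite eq_le M0 andbT -(@pmulr_rle0 _ n.+1%:R^-1) ?invr_gt0 //.
  by rewrite mulrC.
apply/rowP => j; rewrite mxE; apply/eqP; rewrite -normr_le0.
by have := cM j; rewrite Me mul0r.
Qed.

(** * Frames, differentiation along curves, and lifted rays on the graph *)

Section FirstIntegral.
Variable R : realType.
Local Open Scope complex_scope.
Implicit Types (F : ('I_5 -> R) -> R) (x : 'I_5 -> R) (p : pt R).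

Definition graph_pt F x : pt R := fun k =>
  match val k with
  | 0 => x (@Ordinal 5 0 isT) +i* x (@Ordinal 5 1 isT)
  | 1 => x (@Ordinal 5 2 isT) +i* x (@Ordinal 5 3 isT)
  | _ => x (@Ordinal 5 4 isT) +i* F x
  end.

Lemma coords_graph_pt F x : coords (graph_pt F x) = x.
Proof.
by apply/funext => -[[|[|[|[|[|m]]]]] km] //; congr x; exact: val_inj.
Qed.

Lemma pt_ext p q : coords p = coords q -> ImC (p i2) = ImC (q i2) -> p = q.
Proof.
move=> pq pq2; apply/funext => k.
have pqk j : coords p j = coords q j by rewrite pq.
have Cext (z w : R[i]) : ReC z = ReC w -> ImC z = ImC w -> z = w.
  by case: z => a b; case: w => c d /= -> ->.
have [->|->|->] : [\/ k = i0, k = i1 | k = i2].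
  case: k => -[|[|[|m]]] km //.
  - by apply: Or31; exact: val_inj.
  - by apply: Or32; exact: val_inj.
  - by apply: Or33; exact: val_inj.
- apply: Cext; first exact: (pqk (@Ordinal 5 0 isT)).
  exact: (pqk (@Ordinal 5 1 isT)).
- apply: Cext; first exact: (pqk (@Ordinal 5 2 isT)).
  exact: (pqk (@Ordinal 5 3 isT)).
- by apply: Cext => //; exact: (pqk (@Ordinal 5 4 isT)).
Qed.

Lemma vf_sum (Es : 'I_5 -> 'M[R[i]]_4) (c : 'I_5 -> R) p i :
  vf (\sum_(k < 5) (c k)%:C *: Es k) p i = \sum_(k < 5) (c k)%:C * vf (Es k) p i.
Proof.
rewrite /vf summxE; under [RHS]eq_bigr do rewrite mulrDr.
rewrite big_split /=; congr (_ + _); last first.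
  by apply: eq_bigr => k _; rewrite mxE.
under [RHS]eq_bigr do rewrite mulr_sumr.
rewrite exchange_big /=; apply: eq_bigr => j _.
by rewrite summxE mulr_suml; apply: eq_bigr => k _; rewrite mxE mulrA.
Qed.

Lemma ReC_rM (a : R) (z : R[i]) : ReC (a%:C * z) = a * ReC z.
Proof. by rewrite ReC_M mul0r subr0. Qed.

Lemma ImC_rM (a : R) (z : R[i]) : ImC (a%:C * z) = a * ImC z.
Proof. by rewrite ImC_M mul0r addr0. Qed.

Lemma ReC_vf_sum (Es : 'I_5 -> 'M[R[i]]_4) (c : 'I_5 -> R) p i :
  ReC (vf (\sum_(k < 5) (c k)%:C *: Es k) p i) =
  \sum_(k < 5) c k * ReC (vf (Es k) p i).
Proof. by rewrite vf_sum ReC_sum; apply: eq_bigr => k _; rewrite ReC_rM. Qed.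

Lemma ImC_vf_sum (Es : 'I_5 -> 'M[R[i]]_4) (c : 'I_5 -> R) p i :
  ImC (vf (\sum_(k < 5) (c k)%:C *: Es k) p i) =
  \sum_(k < 5) c k * ImC (vf (Es k) p i).
Proof. by rewrite vf_sum ImC_sum; apply: eq_bigr => k _; rewrite ImC_rM. Qed.

Lemma coords_vf_sum (Es : 'I_5 -> 'M[R[i]]_4) (c : 'I_5 -> R) p j :
  coords (vf (\sum_(k < 5) (c k)%:C *: Es k) p) j =
  \sum_(k < 5) c k * coords (vf (Es k) p) j.
Proof.
case: j => -[|[|[|[|[|m]]]]] // ?;
  [exact: ReC_vf_sum|exact: ImC_vf_sum|exact: ReC_vf_sum|exact: ImC_vf_sum|].
exact: ReC_vf_sum.
Qed.

Lemma coords_line p (xi : pt R) (h : R) j :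
  coords (fun k => p k + h%:C * xi k) j = coords p j + h * coords xi j.
Proof.
case: j => -[|[|[|[|[|m]]]]] // ?; rewrite /coords /=;
  by rewrite ?ReC_D ?ImC_D ?ReC_rM ?ImC_rM.
Qed.

(** Pointwise transitivity of the span modulo the [v] direction: every direction in the five
    coordinates of the graph is the projection of some field of the span. *)
Definition framed (Es : 'I_5 -> 'M[R[i]]_4) p : Prop :=
  forall eta : 'I_5 -> R, exists c : 'I_5 -> R,
    coords (vf (\sum_(k < 5) (c k)%:C *: Es k) p) = eta.

(** The matrix of projected fields is the identity at the origin and varies continuously. Nearby its
    entries move by less than 1/6, where 6 = 5 + 1 is the threshold of [near_identity_unitmx], so it
    stays invertible. *)
Lemma near_framed (Es : 'I_5 -> 'M[R[i]]_4) :
  (forall k j, coords (vf (Es k) (fun=> 0)) j = (k == j)%:R) ->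
  \forall p \near near0 R, framed Es p.
Proof.
move=> Es0.
have : \forall p \near near0 R, forall kj : 'I_5 * 'I_5,
    `|(kj.1 == kj.2)%:R - coords (vf (Es kj.1) p) kj.2| < 6%:R^-1.
  apply: filter_forall => -[k j] /=.
  have /cvgrPdist_lt := @cvg_coords_vf R (Es k) j.
  by rewrite Es0; apply; rewrite invr_gt0.
apply: filterS => p Ep eta.
pose A : 'M[R]_5 := \matrix_(k, j) coords (vf (Es k) p) j.
have Au : A \in unitmx.
  by apply: near_identity_unitmx => k j; rewrite mxE; exact: (Ep (k, j)).
exists (fun k => ((\row_j eta j) *m invmx A) 0 k); apply/funext => j.
rewrite coords_vf_sum.
have /rowP /(_ j) := mulmxKV Au (\row_j eta j).
by rewrite !mxE => <-; apply: eq_bigr => k _; rewrite [A k j]mxE.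
Qed.

Definition curve_derive (gam : R -> pt R) (t : R) (xi : pt R) : Prop :=
  forall k, is_derive t 1 (fun s => ReC (gam s k)) (ReC (xi k)) /\
            is_derive t 1 (fun s => ImC (gam s k)) (ImC (xi k)).

(* Gr p k and Gi p k stand for the partial derivatives at p along the real and
   imaginary parts of the k-th coordinate. *)
Definition pairing (Gr Gi : pt R -> 'I_3 -> R) p (xi : pt R) : R :=
  \sum_(k < 3) (Gr p k * ReC (xi k) + Gi p k * ImC (xi k)).

(** Differentiability is stated as the chain rule along all differentiable curves through [p], which
    keeps every computation within derivatives of one real variable. *)
Definition gradient_at (Psi : pt R -> R) (Gr Gi : pt R -> 'I_3 -> R) p : Prop :=
  forall (gam : R -> pt R) (t : R) (xi : pt R), gam t = p ->
    curve_derive gam t xi ->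
    is_derive t 1 (fun s => Psi (gam s)) (pairing Gr Gi p xi).

Lemma pairing_vf_sum Gr Gi (Es : 'I_5 -> 'M[R[i]]_4) (c : 'I_5 -> R) p q :
  (forall k, pairing Gr Gi q (vf (Es k) p) = 0) ->
  pairing Gr Gi q (vf (\sum_(k < 5) (c k)%:C *: Es k) p) = 0.
Proof.
move=> E0; rewrite /pairing.
under eq_bigr => i _.
  rewrite ReC_vf_sum ImC_vf_sum !mulr_sumr -big_split /=.
  under eq_bigr do rewrite mulrCA (mulrCA (Gi _ _)) -mulrDr.
  over.
rewrite exchange_big /= big1 // => k _.
by rewrite -mulr_sumr -/(pairing Gr Gi q (vf (Es k) p)) E0 mulr0.
Qed.

Lemma is_derive_shift (f : R -> R) (t d : R) :
  is_derive (0 : R) (1 : R) (fun h => f (t + h)) d -> is_derive t (1 : R) f d.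
Proof.
move=> fd.
have -> : f = (fun h => f (t + h)) \o (fun s => s - t).
  by apply/funext => s /=; rewrite addrC subrK.
rewrite -[d]mulr1; apply: is_derive1_comp; first by rewrite subrr.
by apply: is_derive_eq; rewrite subr0.
Qed.

(** When the field projects to [x], the line in its direction lies over the ray spanned by [x].
    Tangency then supplies the derivative of [F] along that ray, namely the [v] component of the
    field, so the lifted ray has the field as its velocity. *)
Lemma graph_ray_derive (A : 'M[R[i]]_4) (r : R) F x (t : R) :
  tangent A r F -> hyp r F (graph_pt F (fun k => t * x k)) ->
  coords (vf A (graph_pt F (fun k => t * x k))) = x ->
  curve_derive (fun s => graph_pt F (fun k => s * x k)) t
    (vf A (graph_pt F (fun k => t * x k))).
Proof.
set p := graph_pt F _; set xi := vf A p => tang hp xix.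
have xik j : coords xi j = x j by rewrite xix.
have lin (c : R) : is_derive t (1 : R) (fun s => s * c) c.
  by apply: is_derive_eq; rewrite scaler0 add0r /GRing.scale /= mulr1.
have /tang := hp; rewrite -/xi /Phi => der.
have Fder : is_derive t (1 : R) (fun s => F (fun k => s * x k)) (ImC (xi i2)).
  apply: is_derive_shift.
  (* Along the line [p + h xi] the five coordinates are [(t + h) x]; adding back the affine function
     [v] to [Phi] leaves [F] on the ray. *)
  have -> : (fun h : R => F (fun k => (t + h) * x k)) =
      (fun h : R => F (coords (fun k => p k + h%:C * xi k))
                    - ImC (p i2 + h%:C * xi i2))
      + (fun h : R => ImC (p i2) + h * ImC (xi i2)).
    apply/funext => h; rewrite [RHS]/GRing.add /=.
    rewrite ImC_D ImC_rM subrK; congr F; apply/funext => k.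
    have pk : t * x k = coords p k by rewrite /p coords_graph_pt.
    by rewrite mulrDl pk -xik coords_line.
  apply: is_derive_eq.
  by rewrite scaler0 !add0r mul1r /GRing.scale /= mulr1.
case=> -[|[|[|m]]] // km; split.
- have -> : xi (Ordinal km) = xi i0 by congr xi; exact: val_inj.
  rewrite (xik (@Ordinal 5 0 isT) : ReC (xi i0) = _); exact: lin.
- have -> : xi (Ordinal km) = xi i0 by congr xi; exact: val_inj.
  rewrite (xik (@Ordinal 5 1 isT) : ImC (xi i0) = _); exact: lin.
- have -> : xi (Ordinal km) = xi i1 by congr xi; exact: val_inj.
  rewrite (xik (@Ordinal 5 2 isT) : ReC (xi i1) = _); exact: lin.
- have -> : xi (Ordinal km) = xi i1 by congr xi; exact: val_inj.
  rewrite (xik (@Ordinal 5 3 isT) : ImC (xi i1) = _); exact: lin.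
- have -> : xi (Ordinal km) = xi i2 by congr xi; exact: val_inj.
  rewrite (xik (@Ordinal 5 4 isT) : ReC (xi i2) = _); exact: lin.
- have -> : xi (Ordinal km) = xi i2 by congr xi; exact: val_inj.
  exact: Fder.
Qed.

End FirstIntegral.

(** * From a first integral with positive vertical derivative to affine equivalence *)

Section LocalEquivalence.
Variable R : realType.
Local Open Scope complex_scope.
Implicit Types (F : ('I_5 -> R) -> R) (x : 'I_5 -> R) (p q : pt R).

Lemma finite_pos_lower_bound n (f : 'I_n -> R) :
  (forall k, 0 < f k) -> exists2 d, 0 < d & forall k, d <= f k.
Proof.
move=> f0; exists (\big[Num.min/1]_k f k) => [|k]; last exact: bigmin_le_cond.
by apply: lt_bigmin.
Qed.

Lemma box_margin (s : R) p : box s p -> exists2 d, 0 < d &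
  forall q, (forall k, `|ReC (q k - p k)| < d /\ `|ImC (q k - p k)| < d) -> box s q.
Proof.
move=> ps.
have [|d d0 dle] := @finite_pos_lower_bound 3
    (fun k => Num.min (s - `|ReC (p k)|) (s - `|ImC (p k)|)).
  by move=> k; have [? ?] := ps k; rewrite lt_min !subr_gt0; apply/andP.
exists d => // q qp k; have [qRe qIm] := qp k.
have := dle k; rewrite le_min => /andP[dRe dIm].
rewrite -[q k](subrK (p k)) ReC_D ImC_D; split.
  by apply: (le_lt_trans (ler_normD _ _)); move: qRe dRe; lra.
by apply: (le_lt_trans (ler_normD _ _)); move: qIm dIm; lra.
Qed.

Lemma openC3_affmap_box (A : 'M[R[i]]_3) (b : pt R) (s : R) :
  A \in unitmx -> openC3 (affmap A b @` box s).
Proof.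
move=> Au _ [p ps <-].
have [d d0 dbox] := box_margin s p ps.
pose B := invmx A.
pose K := \sum_(k < 3) \sum_(j < 3) (`|ReC (B k j)| + `|ImC (B k j)|).
have K0 : 0 <= K by apply: sumr_ge0 => k _; apply: sumr_ge0 => j _; exact: addr_ge0.
(* [K] bounds how much the inverse matrix enlarges coordinates; the added 1 keeps the quotient
   defined and makes [K * e < d] strict. *)
exists (d / (K + 1)) => [|q qp]; first by rewrite divr_gt0 // ltr_wpDl.
pose v : 'cV[R[i]]_3 := \col_k (q k - b k).
exists (fun k => (B *m v) k 0); last first.
  apply/funext => k; rewrite /affmap.
  have /colP /(_ k) := mulKVmx Au v; rewrite [v k 0]mxE mxE => ->.
  by rewrite subrK.
apply: dbox => k.
pose e := d / (K + 1).
have Kk : \sum_(j < 3) (`|ReC (B k j)| + `|ImC (B k j)|) <= K.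
  rewrite /K [leRHS](bigD1 k) //= lerDl; apply: sumr_ge0 => i _.
  by apply: sumr_ge0 => j _; exact: addr_ge0.
have Ke : K * e < d.
  by rewrite mulrA ltr_pdivrMr ?ltr_wpDl // mulrDr mulr1 mulrC ltrDl.
have e0 : 0 < e by rewrite divr_gt0 // ltr_wpDl.
pose w := \col_k (q k - affmap A b p k).
have -> : (B *m v) k 0 - p k = (B *m w) k 0.
  have -> : p k = (B *m (A *m \col_k p k)) k 0 by rewrite mulKmx // mxE.
  rewrite -[LHS]/(((B *m v) k 0) + _).
  have -> : w = v - A *m \col_k p k.
    apply/colP => j; rewrite !mxE /affmap opprD addrA addrAC; congr (_ - _).
    by apply: eq_bigr => l _; rewrite mxE.
  rewrite mulmxBr; move: (B *m v) (B *m (A *m _)) => X Y.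
  by rewrite [in RHS]mxE [in RHS]mxE.
have wb j : `|ReC (w j 0)| < e /\ `|ImC (w j 0)| < e by rewrite mxE; exact: qp.
have bound (f : 'I_3 -> R) :
    (forall j, `|f j| <= (`|ReC (B k j)| + `|ImC (B k j)|) * e) ->
    `|\sum_j f j| < d.
  move=> fb; apply: (le_lt_trans (ler_norm_sum _ _ _)).
  apply: (le_lt_trans _ Ke); apply: (le_trans (ler_sum _ (fun j _ => fb j))).
  by rewrite -mulr_suml ler_wpM2r // ltW.
rewrite mxE ReC_sum ImC_sum; split; apply: bound => j; have [wRe wIm] := wb j.
  rewrite ReC_M (le_trans (ler_normB _ _)) // !normrM mulrDl.
  by apply: lerD; rewrite ler_wpM2l // ltW.
rewrite ImC_M (le_trans (ler_normD _ _)) // !normrM mulrDl.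
by apply: lerD; rewrite ler_wpM2l // ltW.
Qed.

Lemma derive_zero_eq (g : R -> R) (a b : R) : a < b ->
  (forall t, a <= t <= b -> is_derive t (1 : R) g 0) -> g a = g b.
Proof.
move=> ab gd.
have [c _ /eqP] : exists2 c, c \in `]a, b[%R & g b - g a = 0 * (b - a).
  apply: (@MVT R g (fun=> 0)) => // [t|].
    by rewrite in_itv /= => /andP[at_ tb]; apply: gd; rewrite !ltW.
  apply: derivable_within_continuous => t; rewrite in_itv /= => tab.
  by have [] := gd _ tab.
by rewrite mul0r subr_eq0 => /eqP.
Qed.

Lemma derive_pos_lt (g dg : R -> R) (a b : R) : a < b ->
  (forall t, a <= t <= b -> is_derive t (1 : R) g (dg t) /\ 0 < dg t) ->
  g a < g b.
Proof.
move=> ab gd.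
have [c] : exists2 c, c \in `]a, b[%R & g b - g a = dg c * (b - a).
  apply: (@MVT R g dg) => // [t|].
    by rewrite in_itv /= => /andP[at_ tb]; have [] := gd t; rewrite ?ltW.
  apply: derivable_within_continuous => t; rewrite in_itv /= => tab.
  by have [[]] := gd _ tab.
rewrite in_itv /= => /andP[ac cb] gab.
have [|_ dgc] := gd c; first by rewrite !ltW.
by rewrite -subr_gt0 gab mulr_gt0 // subr_gt0.
Qed.

(** The vertical segment from [p] to [q] stays in the box by convexity, and the derivative of [Psi]
    along it is [Gi] at [i2], which is positive. *)
Lemma first_integral_lt_vertical (s : R) (Psi : pt R -> R) Gr Gi p q :
  (forall p, box s p -> gradient_at R Psi Gr Gi p /\ 0 < Gi p i2) ->
  box s p -> box s q -> coords p = coords q -> ImC (p i2) < ImC (q i2) ->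
  Psi p < Psi q.
Proof.
move=> grad ps qs pq pq2.
pose gam (v : R) : pt R := fun k => if k == i2 then ReC (p i2) +i* v else p k.
have gamE (q' : pt R) : coords p = coords q' -> gam (ImC (q' i2)) = q'.
  move=> pq'; apply: pt_ext; last by rewrite /gam eqxx.
  by rewrite -pq'; apply/funext => -[[|[|[|[|[|m]]]]] ?].
rewrite -{1}(gamE p erefl) -(gamE q pq).
pose xi : pt R := fun k => if k == i2 then 'i else 0.
apply: (@derive_pos_lt (Psi \o gam) (fun v => Gi (gam v) i2)) => // v vpq.
have gs : box s (gam v).
  move=> k; rewrite /gam; case: eqP => [_|_]; last exact: ps.
  have [pRe pIm] := ps i2; have [_ qIm] := qs i2; split => //=.
  move: pIm qIm vpq; rewrite !ltr_norml => /andP[? ?] /andP[? ?] /andP[? ?].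
  by apply/andP; split; lra.
have [grad_gam pos] := grad _ gs; split => //.
have -> : Gi (gam v) i2 = pairing R Gr Gi (gam v) xi.
  rewrite /pairing (bigD1 i2) // big1 => [|k /negbTE k2].
    by rewrite /xi eqxx /= mulr0 mulr1 add0r addr0.
  by rewrite /xi k2 /= !mulr0 addr0.
apply: grad_gam => // k; rewrite /gam /xi; case: (k == i2) => /=; split;
  by [exact: is_derive_cst | exact: is_derive_id].
Qed.

(** Each ray from 0 lifts to the hypersurface with velocity in the span of the fields, so [Psi]
    keeps its value 0 along it. Conversely, vertical monotonicity allows only one zero of [Psi] over
    each point of the five coordinates. The hypersurface is thus locally the zero set of [Psi],
    which the affine map carries to [Q]. *)
Lemma first_integral_equiv (Es : 'I_5 -> 'M[R[i]]_4) (r : R) F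
    (Psi : pt R -> R) Gr Gi (A : 'M[R[i]]_3) (b : pt R) (Q : set (pt R)) :
  integral_variety Es r F ->
  (forall k j, coords (vf (Es k) (fun=> 0)) j = (k == j)%:R) ->
  A \in unitmx -> Psi (fun=> 0) = 0 ->
  (\forall p \near near0 R, gradient_at R Psi Gr Gi p) ->
  (\forall p \near near0 R, forall k, pairing R Gr Gi p (vf (Es k) p) = 0) ->
  (\forall p \near near0 R, 0 < Gi p i2) ->
  (\forall p \near near0 R, Q (affmap A b p) <-> Psi p = 0) ->
  affinely_equiv_at0 (hyp r F) Q.
Proof.
move=> [r0 [Fseries tang]] Es0 Au Psi0 Hgrad Hpair Hpos HQ.
have [s1 s10 Hs1] : near0 R [set p | [/\ framed R Es p, gradient_at R Psi Gr Gi p,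
    (forall k, pairing R Gr Gi p (vf (Es k) p) = 0), 0 < Gi p i2 &
    (Q (affmap A b p) <-> Psi p = 0)]].
  have Hf := near_framed R Es Es0.
  by apply: filter_app HQ; apply: filter_app Hpos; apply: filter_app Hpair;
    apply: filter_app Hgrad; apply: filterS Hf => p.
have [K K0 FK] := normal_series_small R r F r0 Fseries.
pose s2 := Num.min s1 r.
have s20 : 0 < s2 by rewrite lt_min s10.
(* Chosen so that [th * K < s2]: over coordinates below [th * (r / 2)] the graph then stays in the
   box of radius [s2]. *)
pose th := Num.min 1 (s2 / (2 * (K + 1))).
have K1 : 0 < 2 * (K + 1) by lra.
have th0 : 0 < th by rewrite lt_min ltr01 divr_gt0.
have th1 : th <= 1 by rewrite ge_min lexx.
pose s := Num.min (th * (r / 2)) s2.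
have s0 : 0 < s by rewrite lt_min s20 andbT; apply: mulr_gt0 => //; lra.
have ss2 : s <= s2 by rewrite ge_min lexx orbT.
have s2box p : box s2 p -> box s1 p /\ box r p.
  by move=> ps; split => k; have [] := ps k; rewrite /s2 !lt_min
    => /andP[? ?] /andP[? ?]; split.
have Fsmall x : (forall k, `|x k| < s) -> `|F x| < s2.
  move=> xs; have : `|F x| <= th * K.
    apply: FK; first by rewrite ltW.
    by move=> k; apply: ltW; apply: (lt_le_trans (xs k)); rewrite ge_min lexx.
  move/le_lt_trans; apply.
  have : th * (2 * (K + 1)) <= s2 by rewrite -ler_pdivlMr // ge_min lexx orbT.
  by nra.
have graph_s2 x : (forall k, `|x k| < s) -> box s2 (graph_pt R F x).
  move=> xs; have xs2 k : `|x k| < s2 := lt_le_trans (xs k) ss2.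
  by case=> -[|[|[|m]]] // km; split => //=; exact: Fsmall.
have graph_hyp x : (forall k, `|x k| < s) -> hyp r F (graph_pt R F x).
  move=> xs; split; first by have [] := s2box _ (graph_s2 _ xs).
  by rewrite /= coords_graph_pt.
have Psi_graph x : (forall k, `|x k| < s) -> Psi (graph_pt R F x) = 0.
  move=> xs.
  have uxs u : 0 <= u <= 1 -> forall k, `|u * x k| < s.
    move=> /andP[u0 u1] k; rewrite normrM (ger0_norm u0).
    by apply: le_lt_trans (xs k); rewrite ler_piMl.
  pose g u := Psi (graph_pt R F (fun k => u * x k)).
  have : g 0 = g 1.
    apply: derive_zero_eq => // u u01.
    have [g1 _] := s2box _ (graph_s2 _ (uxs u u01)).
    (* The frame provides a field of the span projecting to [x]; it is the velocity of the lifted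
       ray and annihilates [Psi]. *)
    have [fr gr pa _ _] := Hs1 _ g1.
    have [c cx] := fr x.
    rewrite -(pairing_vf_sum R Gr Gi Es c _ _ pa).
    apply: (gr (fun s => graph_pt R F (fun k => s * x k))) => //.
    exact: (graph_ray_derive R _ _ _ _ _ (tang c) (graph_hyp _ (uxs u u01)) cx).
  rewrite /g; have -> : (fun k => 1 * x k) = x by apply/funext => k; rewrite mul1r.
  move=> <-; rewrite -[RHS]Psi0; congr Psi; apply: pt_ext.
    rewrite coords_graph_pt; apply/funext => k; rewrite mul0r.
    by case: k => -[|[|[|[|[|m]]]]].
  apply/eqP; rewrite /= -normr_le0.
  (* The bound with factor 0 forces [F] to vanish at the origin, so the lifted ray starts at the
     origin. *)
  have := FK 0 (fun k => 0 * x k); rewrite lexx ler01 !mul0r; apply => // k.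
  by rewrite mul0r normr0.
have coords_s p : box s p -> forall k, `|coords p k| < s.
  by move=> ps [[|[|[|[|[|m]]]]] ?] //; [have [] := ps i0 | have [] := ps i0
    | have [] := ps i1 | have [] := ps i1 | have [] := ps i2].
have box_s1 p : box s p -> box s1 p.
  move=> ps; apply: (s2box p _).1 => k; have [pRe pIm] := ps k.
  by split; [exact: lt_le_trans pRe ss2 | exact: lt_le_trans pIm ss2].
have graph_eta p : ImC (p i2) = F (coords p) -> graph_pt R F (coords p) = p.
  by move=> pF; apply: pt_ext; rewrite ?coords_graph_pt //= pF.
have grad_pos p : box s1 p -> gradient_at R Psi Gr Gi p /\ 0 < Gi p i2.
  by move=> /Hs1 [].
exists A, b, s, (affmap A b @` box s); split => //; split => //.
split; first exact: openC3_affmap_box.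
apply/seteqP; split => [_ [p [[_ pF] ps] <-]|q [Qp [p ps pq]]].
  split; last by exists p.
  have [_ _ _ _ QPsi] := Hs1 _ (box_s1 _ ps); apply/QPsi.
  by rewrite -(graph_eta p pF); apply: Psi_graph; exact: coords_s.
exists p => //; split => //; rewrite -pq in Qp.
have [_ _ _ _ QPsi] := Hs1 _ (box_s1 _ ps).
have Psip : Psi p = 0 by apply/QPsi.
have cs := coords_s _ ps.
have [gs1 _] := s2box _ (graph_s2 _ cs).
suff <- : graph_pt R F (coords p) = p by exact: graph_hyp.
apply: graph_eta.
(* [p] and the graph point above the same coordinates are both zeros of [Psi]; different heights
   would contradict strict monotonicity. *)
have [lt|lt|//] := ltgtP (ImC (p i2)) (F (coords p)).
  have := first_integral_lt_vertical s1 Psi Gr Gi p _ grad_pos (box_s1 _ ps) gs1.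
  by rewrite coords_graph_pt => /(_ erefl lt); rewrite Psip Psi_graph // ltxx.
have := first_integral_lt_vertical s1 Psi Gr Gi _ p grad_pos gs1 (box_s1 _ ps).
by rewrite coords_graph_pt => /(_ erefl lt); rewrite Psip Psi_graph // ltxx.
Qed.

End LocalEquivalence.

(** * Real form of the five fields, and calculus of gradients and continuity at 0 *)

Section ConcreteFields.
Variable R : realType.
Local Open Scope complex_scope.
Implicit Types (p q : pt R).

Lemma ReC_N (z : R[i]) : ReC (- z) = - ReC z. Proof. by case: z. Qed.
Lemma ImC_N (z : R[i]) : ImC (- z) = - ImC z. Proof. by case: z. Qed.
Lemma ReC_conj (z : R[i]) : ReC z^* = ReC z. Proof. by case: z. Qed.
Lemma ImC_conj (z : R[i]) : ImC z^* = - ImC z. Proof. by case: z. Qed.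
Lemma ReC_real (a : R) : ReC a%:C = a. Proof. by []. Qed.
Lemma ImC_real (a : R) : ImC a%:C = 0. Proof. by []. Qed.
Lemma ReC_nat n : ReC (n%:R : R[i]) = n%:R.
Proof. by rewrite -(rmorph_nat (real_complex R)). Qed.
Lemma ImC_nat n : ImC (n%:R : R[i]) = 0.
Proof. by rewrite -(rmorph_nat (real_complex R)). Qed.
Lemma ReC_natV n : ReC (n%:R^-1 : R[i]) = n%:R^-1.
Proof. by rewrite -(rmorph_nat (real_complex R)) -fmorphV. Qed.
Lemma ImC_natV n : ImC (n%:R^-1 : R[i]) = 0.
Proof. by rewrite -(rmorph_nat (real_complex R)) -fmorphV. Qed.
Lemma ReC_0 : ReC (0 : R[i]) = 0. Proof. by []. Qed.
Lemma ImC_0 : ImC (0 : R[i]) = 0. Proof. by []. Qed.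
Lemma ReC_1 : ReC (1 : R[i]) = 1. Proof. by []. Qed.
Lemma ImC_1 : ImC (1 : R[i]) = 0. Proof. by []. Qed.
Lemma ReC_i : ReC ('i : R[i]) = 0. Proof. by []. Qed.
Lemma ImC_i : ImC ('i : R[i]) = 1. Proof. by []. Qed.

Definition ReImE := (ReC_D, ImC_D, ReC_M, ImC_M, ReC_N, ImC_N, ReC_conj,
  ImC_conj, ReC_real, ImC_real, (ReC_0, ImC_0, ReC_1, ImC_1), (ReC_i, ImC_i),
  (ReC_natV, ImC_natV), (ReC_nat, ImC_nat)).

Definition mx3_of_rows (rows : seq (seq R[i])) : 'M[R[i]]_3 :=
  \matrix_(i < 3, j < 3) nth 0 (nth [::] rows i) j.

Lemma det_mx22 (A : 'M[R[i]]_2) :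
  \det A = A ord0 ord0 * A ord_max ord_max - A ord0 ord_max * A ord_max ord0.
Proof.
have o1 : lift ord0 ord0 = ord_max :> 'I_2 by exact: val_inj.
have o2 : lift ord_max ord0 = ord0 :> 'I_2 by exact: val_inj.
rewrite (expand_det_row _ ord0) !big_ord_recl big_ord0 /cofactor !det_mx11.
by rewrite !mxE o1 o2 /= expr0 expr1 mul1r mulN1r mulrN addr0.
Qed.

Lemma det_mx33 (A : 'M[R[i]]_3) : \det A =
  A i0 i0 * (A i1 i1 * A i2 i2 - A i1 i2 * A i2 i1)
  - A i0 i1 * (A i1 i0 * A i2 i2 - A i1 i2 * A i2 i0)
  + A i0 i2 * (A i1 i0 * A i2 i1 - A i1 i1 * A i2 i0).
Proof.
(* Indexing by natural numbers identifies the entries that cofactor expansion reaches through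
   different ordinal terms. *)
have [f AE] : exists f : nat -> nat -> R[i], forall k l, A k l = f k l.
  by exists (fun k l => A (inord k) (inord l)) => k l; rewrite !inord_val.
rewrite (expand_det_row _ i0) !big_ord_recl big_ord0 /cofactor !det_mx22 !mxE.
by rewrite !AE /= /bump /= !(expr0, expr1, addn0, add0n) expr2; ring.
Qed.

Lemma affmap_row (A : 'M[R[i]]_3) (q p : pt R) k :
  affmap A q p k = A k i0 * p i0 + A k i1 * p i1 + A k i2 * p i2 + q k.
Proof.
have o0 : ord0 = i0 :> 'I_3 by exact: val_inj.
have o1 : lift ord0 ord0 = i1 :> 'I_3 by exact: val_inj.
have o2 : lift ord0 (lift ord0 ord0) = i2 :> 'I_3 by exact: val_inj.
by rewrite /affmap !big_ord_recl !big_ord0 o2 o1 o0 !addr0 !addrA.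
Qed.

Lemma vf_row rows p (k : 'I_3) : vf (mx_of_rows rows) p k =
  let s := nth [::] rows k in
  s`_0 * p i0 + s`_1 * p i1 + s`_2 * p i2 + s`_3.
Proof.
have o0 : ord0 = i0 :> 'I_3 by exact: val_inj.
have o1 : lift ord0 ord0 = i1 :> 'I_3 by exact: val_inj.
have o2 : lift ord0 (lift ord0 ord0) = i2 :> 'I_3 by exact: val_inj.
by rewrite /vf !big_ord_recl !big_ord0 o2 o1 o0 !mxE /= !addr0 !addrA.
Qed.

(** At the origin only the last columns survive: 1 and ['i] in [z1], 1 and ['i] in [z2], and 1 in
    [w], the unit vectors of the five coordinates. *)
Lemma Emats_frame (t1 t3 t4 m1 : R) (k j : 'I_5) :
  coords (vf (Emats t1 t3 t4 m1 k) (fun=> 0)) j = (k == j)%:R.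
Proof.
by case: k => -[|[|[|[|[|k]]]]] // ?; rewrite /Emats /=;
  case: j => -[|[|[|[|[|j]]]]] // ?; rewrite /coords /= vf_row /= !mulr0 !add0r;
  rewrite ?ReImE ?oppr0 ?addr0 ?add0r.
Qed.

Lemma ord3P (P : 'I_3 -> Prop) : P i0 -> P i1 -> P i2 -> forall k, P k.
Proof.
move=> P0 P1 P2; case=> -[|[|[|m]]] // km.
- by rewrite (_ : Ordinal km = i0) //; exact: val_inj.
- by rewrite (_ : Ordinal km = i1) //; exact: val_inj.
- by rewrite (_ : Ordinal km = i2) //; exact: val_inj.
Qed.

Lemma pairingE Gr Gi p (xi : pt R) : pairing R Gr Gi p xi =
  Gr p i0 * ReC (xi i0) + Gi p i0 * ImC (xi i0) +
  (Gr p i1 * ReC (xi i1) + Gi p i1 * ImC (xi i1)) +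
  (Gr p i2 * ReC (xi i2) + Gi p i2 * ImC (xi i2)).
Proof.
have o0 : ord0 = i0 :> 'I_3 by exact: val_inj.
have o1 : lift ord0 ord0 = i1 :> 'I_3 by exact: val_inj.
have o2 : lift ord0 (lift ord0 ord0) = i2 :> 'I_3 by exact: val_inj.
by rewrite /pairing !big_ord_recl big_ord0 o2 o1 o0 addr0 !addrA.
Qed.

Lemma gradient_at_ln (f : pt R -> R) Gr Gi p :
  gradient_at R f Gr Gi p -> 0 < f p ->
  gradient_at R (fun p => ln (f p)) (fun p k => (f p)^-1 * Gr p k)
    (fun p k => (f p)^-1 * Gi p k) p.
Proof.
move=> fG f0 gam t xi gamt cd.
have -> : pairing R (fun p k => (f p)^-1 * Gr p k)
    (fun p k => (f p)^-1 * Gi p k) p xi = (f p)^-1 * pairing R Gr Gi p xi.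
  by rewrite !pairingE; ring.
rewrite -[in X in X * _]gamt -gamt.
apply: (@is_derive1_comp _ (@ln R) (f \o gam)).
  by apply: is_derive1_ln; rewrite /= gamt.
by rewrite gamt; exact: fG.
Qed.

Lemma gradient_at_lin (f g : pt R -> R) (a : R) Gr Gi Hr Hi p :
  gradient_at R f Gr Gi p -> gradient_at R g Hr Hi p ->
  gradient_at R (fun p => f p + a * g p) (fun p k => Gr p k + a * Hr p k)
    (fun p k => Gi p k + a * Hi p k) p.
Proof.
move=> fG gG gam t xi gamt cd.
have df := fG gam t xi gamt cd; have dg := gG gam t xi gamt cd.
apply: is_derive_eq; rewrite !pairingE /GRing.scale /=; ring.
Qed.

Definition grad3 (a b c : R) : 'I_3 -> R := fun k =>
  match val k with 0 => a | 1 => b | _ => c end.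

Section RealFields.
Variables (t1 t3 t4 m1 : R) (p : pt R).
Local Notation x1 := (ReC (p i0)).
Local Notation y1 := (ImC (p i0)).
Local Notation x2 := (ReC (p i1)).
Local Notation y2 := (ImC (p i1)).
Local Notation u := (ReC (p i2)).
Local Notation v := (ImC (p i2)).
Let S := t3 * t3 + t4 * t4.
Let a := x1 + m1 / 2 * v.
Let b := y1 - m1 / 2 * u.

(** Here [a + i b] is [z1 - (i/2) m1 w]. The explicit real polynomials reduce annihilation by the
    fields to field identities. *)
Definition Emats_re (k : 'I_5) : 'I_3 -> R :=
  match val k with
  | 0 => grad3 (t1 * x1 + t3 * x2 - t4 * y2 + (t1 * m1 + S) / 2 * v + 1)
           (2 * (t3 * a + t4 * b)) (- 4 * b)
  | 1 => grad3 (t3 * y2 + t4 * x2 + S / 2 * u) 0 0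
  | 2 => grad3 (t3 * a + t4 * b - m1 * x2) (2 * t4 * y2 + S / 2 * v + 1) (- 2 * y2)
  | 3 => grad3 (t3 * b - t4 * a - m1 * y2) (2 * t3 * y2 + S / 2 * u) (2 * x2)
  | _ => grad3 (S / 2 * y1 - m1 / 2 * (t3 * y2 + t4 * x2) - m1 * S / 4 * u)
           (S / 2 * y2) (1 + S / 2 * v)
  end.

Definition Emats_im (k : 'I_5) : 'I_3 -> R :=
  match val k with
  | 0 => grad3 (t1 * y1 + t3 * y2 + t4 * x2 - (t1 * m1 + S) / 2 * u)
           (2 * (t3 * b - t4 * a)) (4 * a)
  | 1 => grad3 (t4 * y2 - t3 * x2 + S / 2 * v + 1) 0 0
  | 2 => grad3 (t3 * b - t4 * a - m1 * y2) (- 2 * t4 * x2 - S / 2 * u) (2 * x2)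
  | 3 => grad3 (m1 * x2 - (t3 * a + t4 * b)) (- 2 * t3 * x2 + S / 2 * v + 1) (2 * y2)
  | _ => grad3 (m1 / 2 * (t3 * x2 - t4 * y2) - S / 2 * x1 - m1 * S / 4 * v)
           (- (S / 2 * x2)) (- (S / 2 * u))
  end.

Lemma ReC_vf_Emats k i :
  ReC (vf (Emats t1 t3 t4 m1 k) p i) = Emats_re k i.
Proof.
by case: k => -[|[|[|[|[|k]]]]] // ?; move: i; apply: ord3P;
  rewrite vf_row /= ?expr2 !ReImE /Emats_re /grad3 /= /S /a /b; field.
Qed.

Lemma ImC_vf_Emats k i :
  ImC (vf (Emats t1 t3 t4 m1 k) p i) = Emats_im k i.
Proof.
by case: k => -[|[|[|[|[|k]]]]] // ?; move: i; apply: ord3P;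
  rewrite vf_row /= ?expr2 !ReImE /Emats_im /grad3 /= /S /a /b; field.
Qed.

End RealFields.

Definition cont0 (f : pt R -> R) : Prop := f p @[p --> near0 R] --> f (fun=> 0).

Lemma cont0_cst (c : R) : cont0 (fun=> c).
Proof. exact: cvg_cst. Qed.

Lemma cont0_Re k : cont0 (fun p => ReC (p k)).
Proof. exact: cvg_Re_near0. Qed.

Lemma cont0_Im k : cont0 (fun p => ImC (p k)).
Proof. exact: cvg_Im_near0. Qed.

Lemma cont0D f g : cont0 f -> cont0 g -> cont0 (fun p => f p + g p).
Proof. exact: cvgD. Qed.

Lemma cont0N f : cont0 f -> cont0 (fun p => - f p).
Proof. exact: cvgN. Qed.

Lemma cont0M f g : cont0 f -> cont0 g -> cont0 (fun p => f p * g p).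
Proof. exact: cvgM. Qed.

Lemma near_pos f : cont0 f -> 0 < f (fun=> 0) -> \forall p \near near0 R, 0 < f p.
Proof. by move=> fc f0; exact: cvgr_gt fc _ f0. Qed.

End ConcreteFields.

Ltac cont0 := repeat lazymatch goal with
  | |- cont0 _ (fun p => @?f p + @?g p) => apply (cont0D _ f g)
  | |- cont0 _ (fun p => @?f p * @?g p) => apply (cont0M _ f g)
  | |- cont0 _ (fun p => - @?f p) => apply (cont0N _ f)
  | |- cont0 _ (fun p => ReC (p _)) => apply cont0_Re
  | |- cont0 _ (fun p => ImC (p _)) => apply cont0_Im
  | |- cont0 _ (fun=> ?c) => apply cont0_cst
  end.

(** * The degenerate algebras, [t3 = t4 = 0]: models 1 and 2 *)

Section Cases.
Variable R : realType.
Local Open Scope complex_scope.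
Implicit Types (p q : pt R).

(** With [kappa = 0] the first field moves [X] at rate 1 and [v - |z2|^2] at rate [4 X], so
    [v - |z2|^2 - 2 X^2] is invariant. The map replaces [z1] by [z1 - (i/2) m1 w], whose real part
    is [X]. *)
Lemma tube_case (m1 r : R) (F : ('I_5 -> R) -> R) :
  integral_variety (Emats (- 2 * m1) 0 0 m1) r F ->
  affinely_equiv_at0 (hyp r F) (@model1 R).
Proof.
move=> IV.
pose X p := ReC (p i0) + m1 / 2 * ImC (p i2).
pose Psi p := ImC (p i2) - 2 * (X p * X p)
  - (ReC (p i1) * ReC (p i1) + ImC (p i1) * ImC (p i1)).
pose Gr p := grad3 R (- 4 * X p) (- 2 * ReC (p i1)) 0.
pose Gi p := grad3 R 0 (- 2 * ImC (p i1)) (1 - 2 * m1 * X p).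
pose A := mx3_of_rows R
  [:: [:: 1; 0; - 'i * (m1 / 2)%:C]; [:: 0; 1; 0]; [:: 0; 0; 1]].
apply: (first_integral_equiv R _ r F Psi Gr Gi A (fun=> 0) _ IV).
- exact: Emats_frame.
- by rewrite unitmxE (_ : \det A = 1) ?unitr1 // det_mx33 !mxE /=; ring.
- by rewrite /Psi /X !ReImE; ring.
- apply: nearW => p gam t xi <-{p} cd.
  move: (cd i0) (cd i1) (cd i2) => [dx1 dy1] [dx2 dy2] [du dv].
  rewrite pairingE /Psi /Gr /Gi /grad3 /X /=.
  apply: is_derive_eq.
  by rewrite /GRing.scale /=; field.
- apply: filterE => p -[[|[|[|[|[|k]]]]] ?] //;
    by rewrite pairingE !ReC_vf_Emats !ImC_vf_Emats /Emats_re /Emats_im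
      /Gr /Gi /grad3 /X /=; field.
- apply: near_pos; last by rewrite /Gi /grad3 /X /= ?ReImE; lra.
  by rewrite /Gi /grad3 /X /=; cont0.
- apply: nearW => p; rewrite /model1 /= !affmap_row !mxE /= !ReImE /Psi /X.
  by split=> H; lra.
Qed.

(** Under the first field [Y = 1 + kap X] grows at rate [kap Y], hence [ln Y] at rate [kap]. Since
    [v - |z2|^2] grows at rate [4 X], the sum of [kap^2/4 (v - |z2|^2) - kap X] and [ln Y] is
    invariant; [N] is its polynomial part. *)
Lemma log_case (kap m1 r : R) (F : ('I_5 -> R) -> R) : kap != 0 ->
  integral_variety (Emats (kap - 2 * m1) 0 0 m1) r F ->
  affinely_equiv_at0 (hyp r F) (@model2 R).
Proof.
move=> kap0 IV.
pose Y p := 1 + kap * (ReC (p i0) + m1 / 2 * ImC (p i2)).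
pose N p := (kap * kap / 4 - kap * m1 / 2) * ImC (p i2) - kap * ReC (p i0)
  - kap * kap / 4 * (ReC (p i1) * ReC (p i1) + ImC (p i1) * ImC (p i1)).
(* The coefficient 1 gives [Psi] the shape expected by [gradient_at_lin]. *)
pose Psi p := N p + 1 * ln (Y p).
pose Gr p k := grad3 R (- kap) (- (kap * kap / 2) * ReC (p i1)) 0 k
  + 1 * ((Y p)^-1 * grad3 R kap 0 0 k).
pose Gi p k := grad3 R 0 (- (kap * kap / 2) * ImC (p i1))
    (kap * kap / 4 - kap * m1 / 2) k
  + 1 * ((Y p)^-1 * grad3 R 0 0 (kap * m1 / 2) k).
(* In the new coordinates [x1] is [kap X], [z2] is scaled by [kap / 2], and [v] is
   [kap^2/4 v - kap X], so [N] becomes [v - |z2|^2]. *)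
pose A := mx3_of_rows R
  [:: [:: kap%:C; 0; - 'i * (kap * m1 / 2)%:C]; [:: 0; (kap / 2)%:C; 0];
      [:: - 'i * kap%:C; 0; (kap * kap / 4 - kap * m1 / 2)%:C]].
have Ypos : \forall p \near near0 R, 0 < Y p.
  apply: near_pos; last by rewrite /Y /= ?ReImE; lra.
  by rewrite /Y; cont0.
apply: (first_integral_equiv R _ r F Psi Gr Gi A (fun=> 0) _ IV).
- exact: Emats_frame.
- rewrite unitmxE (_ : \det A = (kap ^+ 4 / 8)%:C).
    by rewrite rmorph_unit // unitfE mulf_neq0 // expf_neq0.
  rewrite det_mx33 !mxE /=; apply/eqP; rewrite eq_complex.
  by apply/andP; split; apply/eqP; rewrite -!/(ReC _) -!/(ImC _) !ReImE; field.
- rewrite /Psi /N /Y /= ?ReImE !(mulr0, addr0, mul1r) ln1; ring.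
- apply: filterS Ypos => p Yp; apply: gradient_at_lin.
    move=> gam t xi <-{Yp p} cd.
    move: (cd i0) (cd i1) (cd i2) => [dx1 dy1] [dx2 dy2] [du dv].
    rewrite pairingE /N /grad3 /=.
    apply: is_derive_eq.
    by rewrite /GRing.scale /=; field.
  apply: gradient_at_ln => // gam t xi <-{Yp p} cd.
  move: (cd i0) (cd i1) (cd i2) => [dx1 dy1] [dx2 dy2] [du dv].
  rewrite pairingE /Y /grad3 /=.
  apply: is_derive_eq.
  by rewrite /GRing.scale /=; field.
- apply: filterS Ypos => p Yp -[[|[|[|[|[|k]]]]] ?] //;
    rewrite pairingE !ReC_vf_Emats !ImC_vf_Emats /Emats_re /Emats_im
      /Gr /Gi /grad3 /=; move: Yp; rewrite /Y;
    move: (ReC (p i0)) (ImC (p i0)) (ReC (p i1)) (ImC (p i1)) (ReC (p i2)) (ImC (p i2));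
    move=> x1 y1 x2 y2 u v Yp; field; apply: lt0r_neq0; lra.
(* The vertical derivative of [Psi] multiplied by [Y]; its value at the origin is [kap^2 / 4]. *)
- have : \forall p \near near0 R,
      0 < (kap * kap / 4 - kap * m1 / 2) * Y p + kap * m1 / 2.
    apply: near_pos; first by rewrite /Y; cont0.
    rewrite /Y /= ?ReImE.
    have : 0 < kap * kap by rewrite lt0r sqr_ge0 andbT mulf_neq0.
    by lra.
  apply: filterS2 Ypos => p Yp; rewrite -[in X in _ -> X](pmulr_rgt0 _ Yp).
  by rewrite /Gi /grad3 /=; congr (is_true (0 < _)); field; exact: lt0r_neq0.
- apply: filterS Ypos => p Yp.
  have q0 : 1 + ReC (affmap A (fun=> 0) p i0) = Y p.
    by rewrite affmap_row !mxE /= !ReImE /Y; field.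
  have q1 : ReC (affmap A (fun=> 0) p i1) ^+ 2 + ImC (affmap A (fun=> 0) p i1) ^+ 2
      = kap * kap / 4 * (ReC (p i1) * ReC (p i1) + ImC (p i1) * ImC (p i1)).
    by rewrite affmap_row !mxE /= !ReImE; field.
  have q2 : ImC (affmap A (fun=> 0) p i2) =
      (kap * kap / 4 - kap * m1 / 2) * ImC (p i2) - kap * ReC (p i0).
    by rewrite affmap_row !mxE /= !ReImE; field.
  rewrite /model2 /= q0 q1 q2 /Psi /N; split=> [[_ ->]|H]; first by ring.
  by split => //; lra.
Qed.

End Cases.

(** * The nondegenerate algebra, [S <> 0]: model 3 *)

Section ConeCase.
Variable R : realType.
Local Open Scope complex_scope.
Variables t1 t3 t4 m1 : R.
Implicit Types (mu : R) (p q : pt R).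
Let S := t3 * t3 + t4 * t4.

(* With l = 1 - tau z2 - (i/2) S w, b = z1 - (i/2) m1 w, d = 1 + tau z2 - (i/2) S w:
   cone_l1 + i cone_l2 = l and cone_e1 mu + i cone_e2 mu = mu b + d. *)
Definition cone_l1 p :=
  1 + (t4 * ImC (p i1) - t3 * ReC (p i1)) + S / 2 * ImC (p i2).
Definition cone_l2 p :=
  - (t3 * ImC (p i1) + t4 * ReC (p i1)) - S / 2 * ReC (p i2).
Definition cone_e1 mu p := mu * (ReC (p i0) + m1 / 2 * ImC (p i2))
  + (1 + (t3 * ReC (p i1) - t4 * ImC (p i1)) + S / 2 * ImC (p i2)).
Definition cone_e2 mu p := mu * (ImC (p i0) - m1 / 2 * ReC (p i2))
  + (t3 * ImC (p i1) + t4 * ReC (p i1) - S / 2 * ReC (p i2)).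

(** This is [Re((mu b + d) conj l)], written [P_mu] in the overview. *)
Definition cone_form mu p :=
  cone_l1 p * cone_e1 mu p + cone_l2 p * cone_e2 mu p.

Definition cone_gr mu p : 'I_3 -> R := grad3 R (mu * cone_l1 p)
  (t3 * (cone_l1 p - cone_e1 mu p) + t4 * (cone_l2 p - cone_e2 mu p))
  (- (S / 2 * cone_e2 mu p) - cone_l2 p * (mu * m1 / 2 + S / 2)).

Definition cone_gi mu p : 'I_3 -> R := grad3 R (mu * cone_l2 p)
  (t4 * (cone_e1 mu p - cone_l1 p) + t3 * (cone_l2 p - cone_e2 mu p))
  (S / 2 * cone_e1 mu p + cone_l1 p * (mu * m1 / 2 + S / 2)).

Lemma cone_form_gradient mu p :
  gradient_at R (cone_form mu) (cone_gr mu) (cone_gi mu) p.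
Proof.
move=> gam t xi <-{p} cd.
move: (cd i0) (cd i1) (cd i2) => [dx1 dy1] [dx2 dy2] [du dv].
have dl1 : is_derive t (1 : R) (fun s => cone_l1 (gam s))
    (t4 * ImC (xi i1) - t3 * ReC (xi i1) + S / 2 * ImC (xi i2)).
  rewrite /cone_l1; apply: is_derive_eq; rewrite /GRing.scale /=; by ring.
have dl2 : is_derive t (1 : R) (fun s => cone_l2 (gam s))
    (- (t3 * ImC (xi i1) + t4 * ReC (xi i1)) - S / 2 * ReC (xi i2)).
  rewrite /cone_l2; apply: is_derive_eq; rewrite /GRing.scale /=; by ring.
have de1 : is_derive t (1 : R) (fun s => cone_e1 mu (gam s))
    (mu * (ReC (xi i0) + m1 / 2 * ImC (xi i2))
     + (t3 * ReC (xi i1) - t4 * ImC (xi i1) + S / 2 * ImC (xi i2))).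
  rewrite /cone_e1; apply: is_derive_eq; rewrite /GRing.scale /=; by ring.
have de2 : is_derive t (1 : R) (fun s => cone_e2 mu (gam s))
    (mu * (ImC (xi i0) - m1 / 2 * ReC (xi i2))
     + (t3 * ImC (xi i1) + t4 * ReC (xi i1) - S / 2 * ReC (xi i2))).
  rewrite /cone_e2; apply: is_derive_eq; rewrite /GRing.scale /=; by ring.
rewrite /cone_form; apply: is_derive_eq.
rewrite pairingE /GRing.scale /cone_gr /cone_gi /grad3 /=; by field.
Qed.

(* [mu ^+ 2 = ...] is the characteristic equation of the first generator acting on
   the span of Re (b conj l) and Re (d conj l). *)
Lemma cone_form_invariant mu p (k : 'I_5) :
  mu ^+ 2 = (t1 + 2 * m1) * mu + 4 * S ->
  pairing R (cone_gr mu) (cone_gi mu) p (vf (Emats t1 t3 t4 m1 k) p) =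
  if k == ord0 then mu * cone_form mu p else 0.
Proof.
rewrite /S => hmu.
have -> : pairing R (cone_gr mu) (cone_gi mu) p (vf (Emats t1 t3 t4 m1 k) p) =
    pairing R (cone_gr mu) (cone_gi mu) p
      (fun i => Emats_re R t1 t3 t4 m1 p k i +i* Emats_im R t1 t3 t4 m1 p k i).
  by rewrite !pairingE !ReC_vf_Emats !ImC_vf_Emats.
rewrite pairingE /Emats_re /Emats_im /cone_gr /cone_gi /cone_form /cone_l1
  /cone_l2 /cone_e1 /cone_e2 /S /grad3 /=.
move: (ReC (p i0)) (ImC (p i0)) (ReC (p i1)) (ImC (p i1)) (ReC (p i2)) (ImC (p i2)).
move=> x1 y1 x2 y2 u v.
by case: k => -[|[|[|[|[|k]]]]] // ? /=; field: hmu.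
Qed.

Lemma cont0_cone_form mu : cont0 R (cone_form mu).
Proof. by rewrite /cone_form /cone_l1 /cone_l2 /cone_e1 /cone_e2; cont0. Qed.

Lemma cone_form0 mu : cone_form mu (fun=> 0) = 1.
Proof.
rewrite /cone_form /cone_l1 /cone_l2 /cone_e1 /cone_e2 /= ?ReImE; by ring.
Qed.

Lemma near_cone_form_pos mu : \forall p \near near0 R, 0 < cone_form mu p.
Proof. by apply: near_pos; rewrite ?cone_form0 //; exact: cont0_cone_form. Qed.

(** The first field increases [ln P_mu] at rate [mu] and [ln P_nu] at rate [nu], so
    [ln P_mu - (mu/nu) ln P_nu] is a first integral; the exponent is negative because the roots have
    opposite signs. *)
Lemma cone_case (r : R) (F : ('I_5 -> R) -> R) : S != 0 ->
  integral_variety (Emats t1 t3 t4 m1) r F ->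
  exists2 alpha, alpha < 0 & affinely_equiv_at0 (hyp r F) (model3 alpha).
Proof.
move=> S0 IV.
have Spos : 0 < S by rewrite lt0r S0 addr_ge0 ?sqr_ge0.
pose kap := t1 + 2 * m1.
(* Square root of the discriminant of the characteristic equation; [S > 0] makes it exceed [|kap|],
   whence [nu < 0 < mu]. *)
pose d := Num.sqrt (kap ^+ 2 + 16 * S).
have d0 : 0 <= d by exact: sqrtr_ge0.
have d2 : d ^+ 2 = kap ^+ 2 + 16 * S by rewrite sqr_sqrtr; nra.
pose mu := (kap + d) / 2; pose nu := (kap - d) / 2.
have mu2 : mu ^+ 2 = (t1 + 2 * m1) * mu + 4 * S by rewrite -/kap /mu; field: d2.
have nu2 : nu ^+ 2 = (t1 + 2 * m1) * nu + 4 * S by rewrite -/kap /nu; field: d2.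
have mu0 : 0 < mu by rewrite /mu; nra.
have nu0 : nu < 0 by rewrite /nu; nra.
pose al := mu / nu.
have al0 : al < 0 by rewrite pmulr_rlt0 // invr_lt0.
exists al => //.
pose T := t3%:C + 'i * t4%:C.
(* Together with the translation by 1 in each component, the rows are [l], [nu b + d] and
   [mu b + d], so the two forms in [model3] become [P_mu] and [P_nu]. *)
pose A := mx3_of_rows R
  [:: [:: 0; - T; - 'i / 2 * S%:C];
      [:: nu%:C; T; - 'i / 2 * (nu%:C * m1%:C + S%:C)];
      [:: mu%:C; T; - 'i / 2 * (mu%:C * m1%:C + S%:C)]].
pose Gr p k := (cone_form mu p)^-1 * cone_gr mu p k
  + - al * ((cone_form nu p)^-1 * cone_gr nu p k).
pose Gi p k := (cone_form mu p)^-1 * cone_gi mu p k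
  + - al * ((cone_form nu p)^-1 * cone_gi nu p k).
pose Psi p := ln (cone_form mu p) + - al * ln (cone_form nu p).
apply: (first_integral_equiv R _ r F Psi Gr Gi A (fun=> 1) _ IV).
- exact: Emats_frame.
- rewrite unitmxE (_ : \det A = 'i * S%:C * T * (mu - nu)%:C).
    rewrite unitfE !mulf_neq0 //.
    + by rewrite eq_complex /= oner_eq0 andbF.
    + by rewrite eq_complex /= eqxx andbT.
    + apply: contraNneq S0 => T0; rewrite /S.
      have T3 : t3 = 0 by have := congr1 (@ReC R) T0; rewrite /T !ReImE; lra.
      have T4 : t4 = 0 by have := congr1 (@ImC R) T0; rewrite /T !ReImE; lra.
      by rewrite T3 T4 !mul0r addr0.
    + by rewrite eq_complex /= eqxx andbT; apply: lt0r_neq0; lra.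
  by rewrite det_mx33 !mxE /= rmorphB /=; field.
- by rewrite /Psi !cone_form0 ln1 mulr0 addr0.
- apply: filterS2 (near_cone_form_pos mu) (near_cone_form_pos nu) => p mup nup.
  by apply: gradient_at_lin; apply: gradient_at_ln => //; exact: cone_form_gradient.
- apply: filterS2 (near_cone_form_pos mu) (near_cone_form_pos nu) => p mup nup k.
  set xi := vf _ _.
  have -> : pairing R Gr Gi p xi =
      (cone_form mu p)^-1 * pairing R (cone_gr mu) (cone_gi mu) p xi
      - al * ((cone_form nu p)^-1 * pairing R (cone_gr nu) (cone_gi nu) p xi).
    by rewrite !pairingE /Gr /Gi; ring.
  rewrite !cone_form_invariant //; case: ifP => _; last by rewrite !mulr0 subr0.
  rewrite ![_^-1 * _]mulrCA !mulVf ?lt0r_neq0 // !mulr1 /al divfK ?subrr //.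
  exact: ltr0_neq0.
(* The vertical derivative of [Psi] multiplied by [P_mu P_nu]. At the origin the terms in [m1]
   cancel because [al * nu = mu], leaving [S (1 - al) > 0]. *)
- have : \forall p \near near0 R, 0 < cone_gi mu p i2 * cone_form nu p
      - al * (cone_gi nu p i2 * cone_form mu p).
    apply: near_pos.
      rewrite /cone_gi /grad3 /= /cone_form /cone_l1 /cone_l2 /cone_e1 /cone_e2.
      by cont0.
    have alnu : al * nu = mu by rewrite /al divfK // ltr0_neq0.
    have : 0 < S * (1 - al) by rewrite mulr_gt0 // subr_gt0 (lt_trans al0).
    rewrite !cone_form0 /cone_gi /grad3 /cone_l1 /cone_e1 /= ?ReImE -alnu => Sal.
    by rewrite [ltRHS](_ : _ = S * (1 - al)) //; field.
  move=> vert.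
  apply: filterS3 (near_cone_form_pos mu) (near_cone_form_pos nu) vert => p mup nup vert.
  rewrite [ltRHS](_ : _ = (cone_gi mu p i2 * cone_form nu p
      - al * (cone_gi nu p i2 * cone_form mu p)) / (cone_form mu p * cone_form nu p)).
    by rewrite divr_gt0 // mulr_gt0.
  by rewrite /Gi; field; rewrite !lt0r_neq0.
- apply: filterS2 (near_cone_form_pos mu) (near_cone_form_pos nu) => p mup nup.
  have q1 : ReC (affmap A (fun=> 1) p i0 * (affmap A (fun=> 1) p i1)^*) = cone_form nu p.
    rewrite !affmap_row !mxE /= /T !ReImE /cone_form /cone_l1 /cone_l2 /cone_e1 /cone_e2.
    by field.
  have q2 : ReC ((affmap A (fun=> 1) p i0)^* * affmap A (fun=> 1) p i2) = cone_form mu p.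
    rewrite !affmap_row !mxE /= /T !ReImE /cone_form /cone_l1 /cone_l2 /cone_e1 /cone_e2.
    by field.
  rewrite /model3 /= q1 q2 /Psi; split=> [[_ ->]|H].
    by rewrite ln_powR mulNr subrr.
  split=> //; apply: ln_inj; rewrite ?posrE ?powR_gt0 // ln_powR.
  by apply/eqP; rewrite -subr_eq0 -mulNr H.
Qed.

End ConeCase.
Theorem theorem4p7 (R : realType) (t1 t3 t4 m1 : R) (r : R)
    (F : ('I_5 -> R) -> R) :
  integral_variety (Emats t1 t3 t4 m1) r F ->
  affinely_equiv_at0 (hyp r F) (@model1 R) \/
  affinely_equiv_at0 (hyp r F) (@model2 R) \/
  (exists2 alpha : R, alpha < 0 & affinely_equiv_at0 (hyp r F) (model3 alpha)).
Proof.
(* A vanishing sum of two real squares forces [t3 = t4 = 0], after which [kappa = t1 + 2 m1]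
   separates models 1 and 2. *)
have [S0|S0] := eqVneq (t3 * t3 + t4 * t4) 0; last first.
  by move=> IV; right; right; exact: (cone_case R t1 t3 t4 m1).
have -> : t3 = 0 by nra.
have -> : t4 = 0 by nra.
have [kap0|kap0] := eqVneq (t1 + 2 * m1) 0.
  have -> : t1 = - 2 * m1 by lra.
  by move=> IV; left; exact: (tube_case R m1).
(* Writing [t1] as [kappa - 2 m1] matches the parametrization of [log_case]. *)
rewrite -[t1](addrK (2 * m1)) => IV; right; left.
exact: (log_case R (t1 + 2 * m1) m1).
Qed.
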